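(* Let $K$ be an algebraically closed field of characteristic different from $2$, and let $A$ and $B$ be two finite-dimensional central simple $K$-algebras with involution. Suppose that the involution of $A$ is of orthogonal type and that $A$ satisfies the identities with involution of $B$, i.e. $\mathrm{Id}(B,* )\subseteq \mathrm{Id}(A,* )$. Then there exists an involution-preserving embedding of $A$ into $B$.
   Context: An involution on a $K$-algebra $A$ is a $K$-linear map $*\colon A\to A$ with $(ab)^*=b^*a^*$ and $(a^* )^*=a$. Put $A^+=\{a: a^*=a\}$ and $A^-=\{a: a^*=-a\}$. Let $K\langle Y,Z\rangle$ be the free associative algebra on countably many non-commuting variables $y_1,y_2,\dots$ (symmetric) and $z_1,z_2,\dots$ (skew-symmetric). A polynomial $f(y_1,\dots,y_p,z_1,\dots,z_q)\in K\langle Y,Z\rangle$ is an identity with involution ($*$-identity) of $(A,* )$ if $f(u_1,\dots,u_p,v_1,\dots,v_q)=0$ for all $u_i\in A^+$ and $v_j\in A^-$. The set of all $*$-identities of $(A,* )$ is denoted $\mathrm{Id}(A,* )$. A central simple algebra with involution over $K$ is of orthogonal type if it is isomorphic, as an algebra with involution, to $(M_n(K),t)$ for some $n\ge 1$, where $t$ is the transpose, and of symplectic type if it is isomorphic to $(M_{2k}(K),s)$ for some $k\geq 1$, where $a^s=Ta^tT^{-1}$ with $T=\sum_{i=1}^{k}(e_{i,i+k}-e_{i+k,i})$ ($e_{ij}$ matrix units). Every finite-dimensional central simple $K$-algebra with involution is of one of these two types. An embedding of $K$-algebras is an injective $K$-linear multiplicative map; it is not required to send the unit to the unit. An embedding $\varphi\colon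 A\to B$ of algebras with involution is involution-preserving if $\varphi(a^{*})=\varphi(a)^{*}$ for all $a\in A$ (each side using the involution of the respective algebra). *)

(* Defs.v *)
From HB Require Import structures.
From mathcomp Require Import all_boot all_algebra all_field.
From mathcomp.multinomials Require Export monalg.

Set Implicit Arguments.
Unset Strict Implicit.
Unset Printing Implicit Defensive.

Import GRing.Theory.
Local Open Scope ring_scope.

Section Defs.

Variable K : fieldType.

Record involution (A : algType K) := Involution {
  star :> {linear A -> A};
  starM : forall a b : A, star (a * b) = star b * star a;
  starK : forall a : A, star (star a) = a
}.

Definition symmetric_elt (A : algType K) (s : involution A) (a : A) : Prop :=
  s a = a.

Definition skew_elt (A : algType K) (s : involution A) (a : A) : Prop :=
  s a = - a.

(* The free unital associative algebra K<Y,Z>: the monoid algebra of the free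
   monoid on nat + nat, where inl i stands for y_i and inr j for z_j. *)
Definition free_alg : Type := {malg K[{fmonom (nat + nat)%type}]}.

Definition free_eval (A : algType K) (u v : nat -> A) (f : free_alg) : A :=
  mmap (in_alg A)
    (fun m : {fmonom (nat + nat)%type} =>
       \prod_(x <- m) (match x with inl i => u i | inr j => v j end)) f.

(* Assignments are total on the variables; since f involves only finitely many
   of them (and 0 is both symmetric and skew), this is the same as quantifying
   over values of the variables occurring in f. *)
Definition star_identity (A : algType K) (s : involution A) (f : free_alg) :
  Prop :=
  forall u v : nat -> A,
    (forall i, symmetric_elt s (u i)) -> (forall j, skew_elt s (v j)) ->
    free_eval u v f = 0.

Definition two_sided_ideal (A : falgType K) (I : {vspace A}) : Prop :=
  forall a x : A, x \in I -> a * x \in I /\ x * a \in I.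

(* A falgType is unital with 1 != 0 and finite-dimensional over K, so its ideals
   are subspaces and the zero algebra is excluded. *)
Definition central_simple (A : falgType K) : Prop :=
  ('Z({:A}) = 1)%VS /\
  forall I : {vspace A}, two_sided_ideal I -> I = 0%VS \/ I = {:A}%VS.

(* phi need not map 1 to 1 *)
Definition star_embedding (A B : algType K) (sA : involution A)
    (sB : involution B) (phi : {linear A -> B}) : Prop :=
  [/\ injective phi,
      forall a b : A, phi (a * b) = phi a * phi b
    & forall a : A, phi (sA a) = sB (phi a)].

Definition star_isomorphic (A B : algType K) (sA : involution A)
    (sB : involution B) : Prop :=
  exists phi : {linear A -> B}, star_embedding sA sB phi /\ bijective phi.

Definition transpose_involution (n : nat) : involution 'M[K]_n.+1 :=
  @Involution 'M[K]_n.+1 (@trmx K n.+1 n.+1)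
    (@trmx_mul K n.+1 n.+1 n.+1) (@trmxK K n.+1 n.+1).

(* n ranges over nat, so that the matrix size n.+1 ranges over all n >= 1 *)
Definition orthogonal_type (A : algType K) (s : involution A) : Prop :=
  exists n : nat, star_isomorphic s (transpose_involution n).

End Defs.

(* Main.v *)
(* Let A = (M_n(K), t).  Choose a nonzero symmetric u in B with dim uB minimal.
   For symmetric t, an eigenvalue z of left multiplication by u t on uB makes
   u t u - z u a symmetric element generating a smaller right ideal, so that
   u t u = z u.  Hence x |-> u x w x* u is, for each symmetric w, a K-valued
   quadratic form, and simplicity of B makes it nonzero when w is.

   Elements x_1, ..., x_n with u x_i x_j* u = delta_ij u give matrix units
   E_ij = x_i* u x_j with E_ij* = E_ji, i.e. an embedding of A.  They exist as
   soon as some symmetric b has a minimal polynomial mu of degree at least n: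
   for generic x the functional p |-> u x p(b) x* u on K[b] does not vanish at
   any of the socle elements (mu / (X - z))(b), so the form
   (p, q) |-> u x p(b) q(b) x* u is nondegenerate and has an orthonormal basis.

   If all symmetric b had degree < n, the Capelli-type polynomial
     sum_sigma sgn(sigma) prod_(0 <= i < n) y_0^sigma(i) y_(i+1)
   would be an identity of B, but for y_0 diagonal with distinct entries and
   y_(i+1) = e_(i,i+1) + e_(i+1,i) it has a Vandermonde entry on M_n(K). *)

Require Import Defs.
From HB Require Import structures.
From mathcomp Require Import all_boot all_fingroup all_algebra all_field.
From mathcomp Require Import ring.
From Stdlib Require Import Classical.

Set Implicit Arguments.
Unset Strict Implicit.
Unset Printing Implicit Defensive.

Import GRing.Theory.
Local Open Scope ring_scope.

(** * Ideals and primeness in a simple algebra *)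

Section SimpleAlgebra.

Variables (K : fieldType) (B : falgType K).
Hypothesis simpleB :
  forall I : {vspace B}, two_sided_ideal I -> I = 0%VS \/ I = {:B}%VS.

(** The ideal [B s B] is nonzero, hence all of [B]. A linear condition on [z] therefore needs
    checking only on the products [x s y]. *)
Lemma simple_ind (s : B) (W : {vspace B}) :
  s != 0 -> (forall x y, x * s * y \in W) -> forall z, z \in W.
Proof.
move=> s0 sW z; set I := ({:B} * <[s]> * {:B})%VS.
have sI x y : x * s * y \in I by rewrite !memv_mul ?memvf ?memv_line.
have [I0|IT] : I = 0%VS \/ I = {:B}%VS.
- apply: simpleB => a x xI; split.
  + have /subvP : ({:B} * I <= I)%VS.
      by rewrite /I !prodvA !prodvSl ?subvf.
    by apply; rewrite memv_mul ?memvf.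
  + have /subvP : (I * {:B} <= I)%VS.
      by rewrite /I -!prodvA !prodvSr ?subvf.
    by apply; rewrite memv_mul ?memvf.
- by have := sI 1 1; rewrite I0 memv0 mul1r mulr1 (negPf s0).
have /subvP : (I <= W)%VS.
  apply/prodvP => a y aI _; move: aI => aI.
  have /subvP/(_ _ aI) : ({:B} * <[s]> <= amulr y @^-1: W)%VS.
    apply/prodvP => x _ _ /vlineP[k ->].
    by rewrite -memv_preim lfunE /= -scalerAr -scalerAl memvZ.
  by rewrite -memv_preim lfunE.
by apply; rewrite IT memvf.
Qed.

(** The left annihilator of [v] contains every [x u y], hence also 1. *)
Lemma simple_prime (u : B) : u != 0 ->
  forall v, (forall x, u * x * v = 0) -> v = 0.
Proof.
move=> u0 v uv; have := @simple_ind u (lker (amulr v)) u0 _ 1.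
rewrite memv_ker lfunE /= mul1r => H; apply/eqP/H => x y.
by rewrite memv_ker lfunE /= -!mulrA [u * _]mulrA uv mulr0.
Qed.

End SimpleAlgebra.

Lemma natr2_neq0 (K : fieldType) : 2%N \notin [pchar K] -> (2 : K) != 0.
Proof. by rewrite inE. Qed.

(** * Minimal polynomials and eigenvectors of left multiplication *)

Section MinimalPolynomial.

Variables (K : fieldType) (B : falgType K).
Implicit Types (b : B) (p : {poly K}).

Lemma horner_algE b p : horner_alg b p = \sum_(i < size p) p`_i *: b ^+ i.
Proof.
rewrite -[in LHS](coefK p) poly_def rmorph_sum; apply: eq_bigr => i _ /=.
by rewrite -mul_polyC rmorphM rmorphXn /= horner_algX horner_algC mulr_algl.
Qed.

(** The powers of [b] up to the dimension of [B] are one too many to be linearly independent. *)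
Lemma annihilating_poly b : exists2 p : {poly K}, p != 0 & horner_alg b p = 0.
Proof.
apply: NNPP => nop; pose X := [tuple b ^+ i | i < (\dim {:B}).+1].
have /eqP dX : free X.
  apply/freeP => k kX i.
  pose p := \poly_(j < (\dim {:B}).+1) k (inord j).
  have p0 : p == 0.
    apply/negPn/negP => pn0; apply: nop; exists p => //.
    rewrite /p poly_def rmorph_sum -[RHS]kX; apply: eq_bigr => j _ /=.
    rewrite inord_val -mul_polyC rmorphM rmorphXn /= horner_algX horner_algC.
    by rewrite mulr_algl nth_mktuple.
  have /(congr1 (fun q : {poly K} => q`_i)) := eqP p0.
  by rewrite coef_poly ltn_ord inord_val coef0.
by have := dimvS (subvf <<X>>); rewrite dX size_tuple ltnn.
Qed.

Lemma minimal_poly b :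
  exists2 mu : {poly K}, mu != 0 & forall p, horner_alg b p = 0 <-> mu %| p.
Proof.
have [q q0 qb] := annihilating_poly b.
have [n] := ubnP (size q); elim: n q q0 qb => // n IH q q0 qb qn.
have [[r [r0 rb rq]]|nor] :=
    classic (exists r, [/\ r != 0, horner_alg b r = 0 & (size r < size q)%N]).
  by apply: (IH r) => //; apply: leq_trans rq _.
exists q => // p; split=> [pb|/dvdpP[r ->]];
  last by rewrite rmorphM /= qb mulr0.
apply/negPn/negP => npq; apply: nor; exists (p %% q); split=> //.
  by move: pb; rewrite {1}(divp_eq p q) rmorphD rmorphM /= qb mulr0 add0r.
by rewrite ltn_modp.
Qed.

End MinimalPolynomial.

(** A polynomial killing [c] splits into linear factors. Applied to [w] one at a time, they give a
    last nonzero vector, which is an eigenvector. The predicate [P] keeps track of an invariant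
    subset, later the right ideal [uB]. *)
Lemma left_eigenvector (K : closedFieldType) (B : falgType K) (c w : B)
    (P : B -> Prop) :
    (forall z v, P v -> P ((c - z%:A) * v)) -> P w -> w != 0 ->
  exists z v, [/\ v != 0, P v & (c - z%:A) * v = 0].
Proof.
move=> Pc Pw w0; have [q q0 qc] := annihilating_poly c.
have [r qr] := closed_field_poly_normal q.
have : (\prod_(z <- r) (c - z%:A)) * w = 0.
  have lq : lead_coef q != 0 by rewrite lead_coef_eq0.
  move: qc; rewrite qr -mul_polyC rmorphM /= horner_algC mulr_algl.
  rewrite rmorph_prod /=.
  move/eqP; rewrite scaler_eq0 (negPf lq) /= => /eqP qc.
  rewrite -[RHS](mul0r w) -qc; congr (_ * w); apply: eq_bigr => z _.
  by rewrite rmorphB /= horner_algX horner_algC.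
elim: {q q0 qc qr} r => [|z r IH].
  by rewrite big_nil mul1r => /eqP; rewrite (negPf w0).
rewrite big_cons -mulrA.
case: (eqVneq (\prod_(j <- r) (c - j%:A) * w) 0) => [/IH //|v0 zv].
exists z, (\prod_(j <- r) (c - j%:A) * w); split=> //.
elim: {IH v0 zv} r => [|y r IH]; first by rewrite big_nil mul1r.
by rewrite big_cons -mulrA; apply: Pc.
Qed.

(** * Minimal symmetric elements and the quadratic forms they define *)

Section Involution.

Variables (K : closedFieldType) (B : falgType K) (s : involution B).
Hypothesis char_neq2 : 2%N \notin [pchar K].
Hypothesis simpleB :
  forall I : {vspace B}, two_sided_ideal I -> I = 0%VS \/ I = {:B}%VS.

Lemma star1 : s 1 = 1.
Proof. by rewrite -{1}[s 1]mul1r -{1}[1](starK s) -starM mul1r starK. Qed.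

Lemma starX b k : s (b ^+ k) = s b ^+ k.
Proof.
by elim: k => [|k IH]; rewrite ?expr0 ?star1 // exprSr starM IH exprS.
Qed.

Lemma star_horner_alg b (p : {poly K}) : s b = b ->
  s (horner_alg b p) = horner_alg b p.
Proof.
move=> sb; rewrite horner_algE linear_sum; apply: eq_bigr => i _.
by rewrite linearZ /= starX sb.
Qed.

(** Descent on the dimension of [uB], the image of [amull u], starting from the symmetric element
    1. *)
Lemma minimal_symmetric : exists u,
  [/\ u != 0, s u = u & forall t, s t = t -> u * t * u \in <[u]>%VS].
Proof.
have [n] := ubnP (\dim (limg (amull (1 : B)))).
elim: n (1 : B) (oner_neq0 B) star1 => // n IH u u0 su un.
have [[t [st utu]]|not] :=
    classic (exists t, s t = t /\ u * t * u \notin <[u]>%VS); last first.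
  exists u; split=> // t st; apply/negPn/negP => utu.
  by apply: not; exists t.
have [z [v [v0 [y vE] zv]]] : exists z v,
    [/\ v != 0, exists y, v = u * y & (u * t - z%:A) * v = 0].
  apply: (left_eigenvector _ _ u0) => [z _ [y ->]|];
    last by exists 1; rewrite mulr1.
  exists (t * u * y - z *: y).
  by rewrite mulrBl mulrBr mulr_algl !mulrA scalerAr.
pose u' := (u * t - z%:A) * u.
apply: (IH u').
- apply: contra utu; rewrite /u' mulrBl subr_eq0 mulr_algl => /eqP ->.
  by rewrite memvZ // memv_line.
- rewrite /u' mulrBl mulr_algl linearB linearZ /= !starM su st mulrA //.
rewrite ltnS in un; apply: leq_trans un.
(* [u'B] is the image of [uB] under left multiplication by [u t - z]. Its dimension is strictly
   smaller because the eigenvector [v] is a nonzero element of [uB] in the kernel. *)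
have -> : amull u' = (amull (u * t - z%:A) \o amull u)%VF.
  by apply/lfunP => a; rewrite comp_lfunE !lfunE /= mulrA.
rewrite limg_comp -[X in (_ < X)%N](limg_ker_dim (amull (u * t - z%:A))).
rewrite -[X in (X < _)%N]add0n ltn_add2r lt0n dimv_eq0; apply/negP => /eqP k0.
have : v \in (limg (amull u) :&: lker (amull (u * t - z%:A)))%VS.
  rewrite memv_cap memv_ker lfunE /= zv eqxx andbT vE.
  by have := memv_img (amull u) (memvf y); rewrite lfunE.
by rewrite k0 memv0 (negPf v0).
Qed.

Lemma eq_opp_eq0 (V : lmodType K) (v : V) : v = - v -> v = 0.
Proof.
move=> vN; apply/eqP.
have : (2 : K) *: v == 0 by rewrite scaler_nat mulr2n {2}vN subrr.
by rewrite scaler_eq0 (negPf (natr2_neq0 char_neq2)).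
Qed.

Variable u : B.
Hypotheses (u0 : u != 0) (su : s u = u).

(* If every [u z u] is skew then [u x u y u = - u y u x u]; moving three factors
   cyclically flips the sign an odd number of times. *)
Lemma not_all_skew : ~ (forall z, s (u * z * u) = - (u * z * u)).
Proof.
move=> skew.
have a x y : u * x * u * y * u = - (u * y * u * x * u).
  apply: oppr_inj; rewrite opprK.
  have := skew (x * u * y); rewrite !mulrA => <-.
  have e z : u * s z * u = - (u * z * u) by rewrite -skew !starM su mulrA.
  rewrite !starM su !mulrA e !mulNr.
  have -> : u * y * u * s x * u = u * y * (u * s x * u) by rewrite !mulrA.
  by rewrite e mulrN opprK !mulrA.
have c x y z : u * x * u * y * u * z * u = 0.
  apply: (@eq_opp_eq0 B).
  have := a x (y * u * z); rewrite !mulrA => {1}->.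
  have := a y (z * u * x); rewrite !mulrA => {1}->.
  rewrite opprK.
  by have := a z (x * u * y); rewrite !mulrA.
(* Primeness strips the left factors [u x], [u y], [u z] in turn, leaving [u = 0]. *)
have prime := @simple_prime _ _ simpleB u u0.
move/eqP: u0; apply; apply: (prime) => x; apply: (prime) => y.
by apply: (prime) => z; rewrite !mulrA c.
Qed.

(** If the form vanished identically, polarisation would make every [u x w y u] skew. Skewness of
    [u z u] is linear in [z], the kernel of [f] below, so by simplicity it would spread from the
    products [x w y] to all [z], which [not_all_skew] excludes. *)
Lemma symmetric_form_neq0 w : s w = w -> w != 0 ->
  exists x, u * x * w * s x * u != 0.
Proof.
move=> sw w0; apply: NNPP => nox.
have iso x : u * x * w * s x * u = 0.
  by apply/eqP/negPn/negP => h; apply: nox; exists x.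
have lin x y : u * x * w * y * u = - (u * s y * w * s x * u).
  have := iso (x + s y).
  rewrite linearD /= starK !(mulrDl, mulrDr) iso add0r.
  have := iso (s y); rewrite starK => ->; rewrite addr0 => /eqP.
  by rewrite addrC addr_eq0 => /eqP.
apply: not_all_skew => z; apply/eqP; rewrite -addr_eq0.
pose f : 'End(B) :=
  ((linfun s \o amull u \o amulr u) + (amull u \o amulr u))%VF.
have fE y : f y = s (u * y * u) + u * y * u.
  by rewrite /f add_lfunE !comp_lfunE !lfunE /= !mulrA.
rewrite -fE -memv_ker; apply: (simple_ind simpleB w0) => x y.
by rewrite memv_ker fE !mulrA !starM su sw !mulrA (lin x y) subrr.
Qed.

End Involution.

(** * Nonroots of polynomials and orthonormal vectors for symmetric matrices *)

(** If [p] vanished everywhere, [p + 1] would have no root and so be constant, forcing [p = 0]. *)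
Lemma exists_nonroot (K : closedFieldType) (p : {poly K}) :
  p != 0 -> exists x, p.[x] != 0.
Proof.
move=> p0; apply: NNPP => nox.
have px x : p.[x] = 0 by apply/eqP/negPn/negP => px; apply: nox; exists x.
have [x] : exists x, root (p + 1) x.
  apply/closed_rootP; rewrite size_polyDl ?size_poly1.
    apply/eqP => /eqP/size_poly1P[c c0 pc].
    by move: (px 0); rewrite pc hornerC => /eqP; apply/negP.
  rewrite ltnNge; apply/negP => /size1_polyC pc.
  by move: p0 (px 0); rewrite pc hornerC polyC_eq0 => /eqP.
by rewrite /root hornerD px add0r hornerC oner_eq0.
Qed.

(** Gram-Schmidt: polarisation yields an anisotropic vector, a square root normalises it, and
    splitting it off lowers the rank by at most one. *)
Lemma orthonormal_rows (K : closedFieldType) (n m : nat) (G : 'M[K]_m) :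
    2%N \notin [pchar K] -> G^T = G -> (n <= \rank G)%N ->
  exists P : 'M_(n, m), P *m G *m P^T = 1%:M.
Proof.
move=> char2; elim: n G => [|n IH] G sG rG.
  by exists 0; apply/matrixP => -[].
have [v vGv] : exists v : 'rV_m, v *m G *m v^T = 1%:M.
  have [v v0] : exists v : 'rV_m, (v *m G *m v^T) 0 0 != 0.
    apply: NNPP => nov.
    have iso (v : 'rV_m) : v *m G *m v^T = 0.
      apply/matrixP => i j; rewrite !ord1 [RHS]mxE.
      by apply/eqP/negPn/negP => h; apply: nov; exists v.
    have bil (v w : 'rV_m) : v *m G *m w^T = 0.
      apply: (eq_opp_eq0 char2); apply/eqP; rewrite -addr_eq0.
      have := iso (v + w).
      rewrite linearD /= !(mulmxDl, mulmxDr) !iso add0r addr0.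
      suff -> : w *m G *m v^T = v *m G *m w^T by move=> ->.
      apply/matrixP => i j; rewrite !ord1 -[in LHS](trmxK (w *m _ *m _)).
      by rewrite mxE !trmx_mul trmxK sG mulmxA.
    move: rG; rewrite (_ : G = 0) ?mxrank0 //; apply/matrixP => i j.
    have /matrixP/(_ 0 0) := bil (delta_mx 0 i) (delta_mx 0 j).
    by rewrite -rowE trmx_delta -colE !mxE.
  pose a := (v *m G *m v^T) 0 0; rewrite -/a in v0.
  have [r /eqP] : exists r, root ('X^2 - a%:P) r.
    by apply/closed_rootP; rewrite size_XnsubC.
  rewrite !hornerE => /eqP; rewrite subr_eq0 => /eqP ra.
  have r0 : r != 0 by apply: contraNneq v0 => r0; rewrite -ra r0 expr0n.
  exists (r^-1 *: v); apply/matrixP => i j; rewrite !ord1.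
  rewrite linearZ /= -!scalemxAl -scalemxAr scalerA [LHS]mxE -/a [RHS]mxE eqxx.
  by rewrite -ra -invfM -expr2 mulVf ?expf_neq0.
(* A rank-one correction of [G] that puts [v] in the radical. *)
pose G' := G - (G *m v^T) *m (v *m G).
have sG' : G'^T = G' by rewrite /G' linearB /= !trmx_mul trmxK sG.
have rG' : (n <= \rank G')%N.
  rewrite -(leq_add2r 1) addn1; apply: leq_trans rG _.
  have {1}-> : G = G' + (G *m v^T) *m (v *m G) by rewrite subrK.
  apply: leq_trans (mxrank_add _ _) _; rewrite leq_add2l.
  by apply: leq_trans (mxrankM_maxr _ _) _; apply: rank_leq_row.
have [P PG] := IH G' sG' rG'.
pose w := P *m G *m v^T.
have wT : v *m G *m P^T = w^T by rewrite /w !trmx_mul trmxK sG mulmxA.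
(* Projecting the rows of [P] orthogonally to [v] turns their Gram matrix for [G'] into the one for
   [G]. *)
pose Q := P - w *m v.
have QGv : Q *m G *m v^T = 0.
  rewrite /Q !mulmxBl -/w -[X in _ - X]mulmxA -mulmxA (mulmxA v) vGv mulmx1.
  by rewrite subrr.
have vGQ : v *m G *m Q^T = 0.
  by have := congr1 trmx QGv; rewrite !trmx_mul trmxK sG trmx0 mulmxA.
have QGQ : Q *m G *m Q^T = 1%:M.
  rewrite {2}/Q linearB /= mulmxBr trmx_mul mulmxA QGv mul0mx subr0.
  rewrite /Q !mulmxBl -!mulmxA (mulmxA v) wT -PG /G' !mulmxBr !mulmxBl.
  by rewrite !mulmxA /w -!mulmxA (mulmxA v) wT /w !mulmxA.
have colPG : col_mx v Q *m G *m (col_mx v Q)^T = 1%:M.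
  by rewrite tr_col_mx mul_col_mx mul_col_row vGv QGv vGQ QGQ -scalar_mx_block.
by exists (col_mx v Q).
Qed.

(** * Orthonormal families in [B] and the matrix units they give *)

Section OrthonormalFamily.

Variables (K : closedFieldType) (B : falgType K) (s : involution B).
Hypothesis char_neq2 : 2%N \notin [pchar K].
Hypothesis simpleB :
  forall I : {vspace B}, two_sided_ideal I -> I = 0%VS \/ I = {:B}%VS.
Variable u : B.
Hypotheses (u0 : u != 0) (su : s u = u).
Hypothesis umin : forall t, s t = t -> u * t * u \in <[u]>%VS.

(** The coordinate along [u], as a linear function on all of [B]. It thus also applies to cross
    terms [u x w s(y) u], which may lie off the line of [u]. *)
Let kappa : B -> K := coord [tuple u] ord0.

Lemma coord_lineE v : v \in <[u]>%VS -> v = kappa v *: u.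
Proof.
by rewrite -span_seq1 => /(coord_span (X := [tuple u])); rewrite big_ord1.
Qed.

Lemma kappa_neq0 v : v \in <[u]>%VS -> v != 0 -> kappa v != 0.
Proof. by move/coord_lineE => {1}->; rewrite scaler_eq0 negb_or => /andP[]. Qed.

Lemma kappaD v w : kappa (v + w) = kappa v + kappa w.
Proof. exact: linearD. Qed.

Lemma kappaZ a v : kappa (a *: v) = a * kappa v.
Proof. exact: linearZ. Qed.

Lemma kappa_sum (I : finType) (F : I -> B) :
  kappa (\sum_i F i) = \sum_i kappa (F i).
Proof. exact: linear_sum. Qed.

Lemma sandwich x w : s w = w -> u * x * w * s x * u \in <[u]>%VS.
Proof.
move=> sw.
have -> : u * x * w * s x * u = u * (x * w * s x) * u by rewrite !mulrA.
by apply: umin; rewrite !starM starK sw mulrA.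
Qed.

(** Given [x] for the tail and [y] for the new element, every form restricted to the line [x + z y]
    is a nonzero polynomial in [z]. A nonroot of the product of these polynomials serves all forms
    at once. *)
Lemma common_anisotropic (S : seq B) :
    (forall w, w \in S -> s w = w /\ w != 0) ->
  exists x, forall w, w \in S -> kappa (u * x * w * s x * u) != 0.
Proof.
elim: S => [|w S IH] hS; first by exists 0.
have [x xS] : exists x, forall w, w \in S -> kappa (u * x * w * s x * u) != 0.
  by apply: IH => v vS; apply: hS; rewrite inE vS orbT.
have [sw w0] := hS w (mem_head _ _).
have [y yw] := symmetric_form_neq0 char_neq2 simpleB u0 su sw w0.
pose q v := Poly [:: kappa (u * x * v * s x * u);
  kappa (u * x * v * s y * u) + kappa (u * y * v * s x * u);
  kappa (u * y * v * s y * u)].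
have qE v z : (q v).[z] = kappa (u * (x + z *: y) * v * s (x + z *: y) * u).
  rewrite horner_Poly /= linearD linearZ /= !(mulrDl, mulrDr).
  rewrite -!(scalerAl, scalerAr) scalerA !kappaD !kappaZ; ring.
(* The leading coefficient is nonzero for the new [w], the constant one for the elements of [S]. *)
have q0 v : v \in w :: S -> q v != 0.
  rewrite inE => /orP[/eqP ->|/xS h].
    apply: contraNneq (kappa_neq0 (sandwich y sw) yw).
    move/(congr1 (fun p : {poly K} => p`_2)).
    by rewrite coef_Poly coef0 => /= ->.
  apply: contraNneq h.
  move/(congr1 (fun p : {poly K} => p`_0)).
  by rewrite coef_Poly coef0 => /= ->.
have [|z] := @exists_nonroot K (\prod_(v <- w :: S) q v).
  by rewrite prodf_seq_neq0; apply/allP.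
rewrite horner_prod prodf_seq_neq0 => /allP zS.
by exists (x + z *: y) => v /zS /=; rewrite qE.
Qed.

Lemma orthonormal_family n (b : B) (mu : {poly K}) :
    s b = b -> mu != 0 -> (forall p, horner_alg b p = 0 <-> mu %| p) ->
    (n < size mu)%N ->
  exists x : 'I_n -> B, forall i j, u * x i * s (x j) * u = (i == j)%:R *: u.
Proof.
move=> sb mu0 muP nmu; pose D := (size mu).-1.
have DE : size mu = D.+1 by rewrite prednK // lt0n size_poly_eq0.
have [r mur] := closed_field_poly_normal mu.
(* For a root [z] of [mu] this element is nonzero, since the quotient has smaller degree than
   [mu]. *)
pose soc z := horner_alg b (mu %/ ('X - z%:P)).
have [|x xsoc] := @common_anisotropic [seq soc z | z <- r].
  move=> _ /mapP[z zr ->]; split; first exact: star_horner_alg.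
  have zmu : ('X - z%:P) %| mu.
    rewrite dvdp_XsubCl mur rootZ ?lead_coef_eq0 //.
    by rewrite root_prod_XsubC.
  apply/eqP => /muP /dvdp_leq h.
  have q0 : mu %/ ('X - z%:P) != 0.
    by rewrite divp_eq0 polyXsubC_eq0 negb_or mu0 -leqNgt; apply: dvdp_leq.
  by have := h q0; rewrite size_divp ?polyXsubC_eq0 // size_XsubC DE subn1 ltnn.
pose ell p := kappa (u * x * horner_alg b p * s x * u).
have ellE p : u * x * horner_alg b p * s x * u = ell p *: u.
  by apply: coord_lineE; apply: sandwich; apply: star_horner_alg.
have ell_modp p : ell (p %% mu) = ell p.
  rewrite /ell [in RHS](divp_eq p mu) rmorphD rmorphM /=.
  by rewrite (proj2 (muP mu) (dvdpp _)) mulr0 add0r.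
have ell_sum m (c : 'I_m -> K) (p : 'I_m -> {poly K}) :
    ell (\sum_i c i *: p i) = \sum_i c i * ell (p i).
  rewrite /ell rmorph_sum /= mulr_sumr !mulr_suml kappa_sum.
  apply: eq_bigr => i _; rewrite -mul_polyC rmorphM /= horner_algC mulr_algl.
  by rewrite -!(scalerAl, scalerAr) kappaZ.
(* Gram matrix of the form [ell (p q)] in the basis 1, X, ..., X^(D-1) of K[X] modulo [mu]. *)
pose G : 'M[K]_D := \matrix_(i, j) ell ('X^(i + j)).
have GE k (P Q : 'M_(k, D)) i j :
    (P *m G *m Q^T) i j = ell (rVpoly (row i P) * rVpoly (row j Q)).
  have rV (v : 'rV[K]_D) : rVpoly v = \sum_i v 0 i *: 'X^i.
    rewrite /rVpoly poly_def; apply: eq_bigr => l _; congr (_ *: _).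
    by rewrite insubT // => h; congr (v 0 _); apply: val_inj.
  rewrite !rV mulr_suml.
  under [in RHS]eq_bigr => l _ do rewrite -scalerAl mulr_sumr.
  rewrite ell_sum mxE.
  under [in LHS]eq_bigr => l _ do rewrite mxE mulr_suml.
  rewrite exchange_big /=; apply: eq_bigr => l _.
  have -> : \sum_(i0 < D) 'X^l * (row j Q 0 i0 *: 'X^i0)
    = \sum_(i0 < D) row j Q 0 i0 *: 'X^(l + i0).
    by apply: eq_bigr => h _; rewrite -scalerAr exprD.
  rewrite ell_sum mulr_sumr; apply: eq_bigr => h _.
  by rewrite !mxE; ring.
have sG : G^T = G by apply/matrixP => i j; rewrite !mxE addnC.
have rG : row_free G.
  rewrite -kermx_eq0; apply/rowV0P => c /sub_kermxP cG.
  apply/eqP/negPn/negP => c0.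
  pose p := rVpoly c.
  have p0 : p != 0.
    by apply: contraNneq c0 => p0; rewrite -[c]rVpolyK -/p p0 linear0.
  have pq (q : {poly K}) : ell (p * q) = 0.
    have -> : ell (p * q) = ell (p * (q %% mu)).
      by rewrite -ell_modp -modp_mul ell_modp.
    have sq : (size (q %% mu)%R <= D)%N by rewrite -ltnS -DE ltn_modp.
    have := @GE 1%N c (poly_rV (q %% mu)) 0 0.
    by rewrite cG mul0mx mxE !row_id poly_rV_K.
  (* As [p] has degree below [D], [g] is a proper divisor of [mu] and so divides [mu / (X - z)] for
     some root [z]. By Bezout that quotient is a multiple of [p] modulo [mu], so [ell] kills it,
     against the choice of [x]. *)
  pose g := gcdp p mu.
  have [z zh] : exists z, root (mu %/ g) z.
    apply/closed_rootP; apply/eqP => /eqP/size_poly1P[k k0 hk].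
    have : mu %| p.
      have := divpK (dvdp_gcdr p mu); rewrite -/g hk mul_polyC => <-.
      by rewrite dvdpZl // dvdp_gcdl.
    move/(dvdp_leq p0); rewrite leqNgt => /negP; apply.
    by rewrite DE ltnS size_poly.
  have mug : mu = mu %/ g * g by rewrite divpK // dvdp_gcdr.
  have zr : z \in r.
    have : root mu z by rewrite mug rootM zh.
    by rewrite {1}mur rootZ ?lead_coef_eq0 // root_prod_XsubC.
  have : g %| mu %/ ('X - z%:P).
    rewrite {1}mug.
    have /dvdpP[h ->] : ('X - z%:P) %| mu %/ g by rewrite dvdp_XsubCl.
    by rewrite mulrAC mulpK ?polyXsubC_eq0 // dvdp_mulIr.
  case/dvdpP => k kE.
  have [[a c'] /= gE] := Bezoutp p mu.
  have /negP := xsoc _ (map_f soc zr); apply; apply/eqP.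
  rewrite -/(ell _) kE -/g.
  (* The Bezout combination equals [g] only up to a nonzero scalar, here [l2 / l1]. *)
  have /eqpP[[l1 l2] /= /andP[l10 l20] lE] := gE.
  have -> : k * g = p * (l2^-1 *: (l1 *: (k * a)))
      + (l2^-1 *: (l1 *: (k * c'))) * mu.
    have -> : k * g = l2^-1 *: (k * (l2 *: g)).
      by rewrite -scalerAr scalerA mulVf // scale1r.
    rewrite -lE -!scalerAr -!scalerAl -!scalerDr; congr (_ *: (_ *: _)).
    ring.
  by rewrite -ell_modp modpD modp_mull addr0 ell_modp pq.
have [|P PG] := @orthonormal_rows K n D G char_neq2 sG.
  by rewrite (eqP rG) -ltnS -DE.
(* The rows of [P] are coefficient vectors of polynomials orthonormal for [ell (p q)]. *)
exists (fun i => x * horner_alg b (rVpoly (row i P))) => i j.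
rewrite starM (star_horner_alg _ sb) !mulrA.
have -> : u * x * horner_alg b (rVpoly (row i P)) *
      horner_alg b (rVpoly (row j P)) * s x * u
  = u * x * horner_alg b (rVpoly (row i P) * rVpoly (row j P)) * s x * u.
  by rewrite rmorphM /= !mulrA.
by rewrite ellE -GE PG mxE.
Qed.

Lemma matrix_embedding n (x : 'I_n.+1 -> B) :
    (forall i j, u * x i * s (x j) * u = (i == j)%:R *: u) ->
  exists phi : {linear 'M[K]_n.+1 -> B},
    star_embedding (transpose_involution K n) s phi.
Proof.
move=> xP; pose E i j := s (x i) * u * x j.
have EM i j k l : E i j * E k l = (j == k)%:R *: E i l.
  have -> : E i j * E k l = s (x i) * (u * x j * s (x k) * u) * x l.
    by rewrite /E !mulrA.
  by rewrite xP -scalerAr -scalerAl.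
pose f (a : 'M[K]_n.+1) := \sum_i \sum_j a i j *: E i j.
have fL : linear f.
  move=> k a c; rewrite /f scaler_sumr -big_split; apply: eq_bigr => i _ /=.
  rewrite scaler_sumr -big_split; apply: eq_bigr => j _ /=.
  by rewrite !mxE scalerDl scalerA.
pose Lf := GRing.isLinear.Build K 'M[K]_n.+1 B *:%R f fL.
pose phi : {linear 'M[K]_n.+1 -> B} := HB.pack f Lf.
exists phi; split=> [a c|a c|a].
- rewrite /= => fac; apply/matrixP => i j.
  (* Compressing by [u x_i] and [s(x_j) u] recovers each matrix entry, whence injectivity. *)
  have coef d : u * x i * f d * s (x j) * u = d i j *: u.
    rewrite /f mulr_sumr !mulr_suml (bigD1 i) //= [X in _ + X]big1 ?addr0.
      rewrite mulr_sumr !mulr_suml (bigD1 j) //= [X in _ + X]big1 ?addr0.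
        rewrite -!(scalerAr, scalerAl) /E !mulrA xP eqxx scale1r.
        by rewrite xP eqxx scale1r.
      move=> l lj; rewrite -!(scalerAr, scalerAl) /E !mulrA xP eqxx scale1r.
      by rewrite xP (negPf lj) scale0r scaler0.
    move=> k ki; rewrite mulr_sumr !mulr_suml big1 // => l _.
    rewrite -!(scalerAr, scalerAl) /E !mulrA xP eq_sym (negPf ki) scale0r.
    by rewrite !mul0r scaler0.
  have := coef a; rewrite fac coef => /eqP.
  by rewrite -subr_eq0 -scalerBl scaler_eq0 (negPf u0) orbF subr_eq0 => /eqP.
- rewrite /= /f mulr_suml; apply: eq_bigr => i _.
  rewrite mulr_suml.
  transitivity (\sum_k \sum_j (a i k * c k j) *: E i j).
    rewrite exchange_big; apply: eq_bigr => j _ /=.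
    by rewrite mxE scaler_suml.
  apply: eq_bigr => k _.
  rewrite mulr_sumr [RHS](bigD1 k) //= [X in _ + X]big1 ?addr0.
    rewrite mulr_sumr; apply: eq_bigr => j _.
    by rewrite -scalerAl -scalerAr EM eqxx scale1r scalerA.
  move=> k' k'k; rewrite mulr_sumr big1 // => j _.
  by rewrite -scalerAl -scalerAr EM eq_sym (negPf k'k) scale0r !scaler0.
- rewrite /= /f linear_sum exchange_big; apply: eq_bigr => i _ /=.
  rewrite linear_sum; apply: eq_bigr => j _ /=.
  by rewrite mxE linearZ /= /E !starM starK su mulrA.
Qed.

End OrthonormalFamily.

(** * A Capelli-type polynomial detecting the degree of symmetric elements *)

Section Capelli.

Variables (K : fieldType) (N : nat).

Definition capelli_word (sigma : 'S_N) : seq (nat + nat) :=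
  flatten
    [seq nseq (sigma i) (inl 0%N) ++ [:: inl i.+1] | i <- index_enum 'I_N].

Definition capelli : free_alg K :=
  \sum_(sigma : 'S_N) << (-1) ^+ sigma *g FMonom (capelli_word sigma) >>.

(** Here [b] is the value of y_0 and [x i] that of y_(i+1), hence the shift in
    [free_eval_capelli]. *)
Definition capelli_eval (A : algType K) (b : A) (x : nat -> A) : A :=
  \sum_(sigma : 'S_N) (-1) ^+ sigma *: \prod_(i < N) (b ^+ sigma i * x i).

Lemma free_eval_capelli (A : algType K) (u v : nat -> A) :
  free_eval u v capelli = capelli_eval (u 0%N) (fun i => u i.+1).
Proof.
rewrite /free_eval /capelli raddf_sum; apply: eq_bigr => sigma _ /=.
rewrite mmapU /= mulr_algl; congr (_ *: _).
rewrite big_flatten big_map; apply: eq_bigr => i _ /=.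
by rewrite big_cat big_seq1 big_nseq iter_mulr_1.
Qed.

(** The expression alternates in the [N] powers of [b]. After expansion, the coefficient attached to
    [f] is a determinant, and [f] cannot be injective as [m < N], so two rows agree. *)
Lemma capelli_eval_dependent (A : algType K) (b : A) (x : nat -> A) m
    (beta : 'I_m -> A) (C : 'I_N -> 'I_m -> K) : (m < N)%N ->
  (forall i : 'I_N, b ^+ i = \sum_k C i k *: beta k) -> capelli_eval b x = 0.
Proof.
move=> mN bC; rewrite /capelli_eval.
have expand (sigma : 'S_N) : \prod_(i < N) (b ^+ sigma i * x i) =
    \sum_(f : {ffun 'I_N -> 'I_m})
      (\prod_i C (sigma i) (f i)) *: \prod_i (beta (f i) * x i).
  under eq_bigr => i _ do rewrite bC mulr_suml.
  rewrite bigA_distr_bigA; apply: eq_bigr => f _ /=.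
  under eq_bigr => i _ do rewrite -scalerAl.
  by rewrite scaler_prod.
under eq_bigr => sigma _ do rewrite expand scaler_sumr.
rewrite exchange_big big1 // => f _ /=.
under eq_bigr => sigma _ do rewrite scalerA.
rewrite -scaler_suml.
have -> : \sum_(sigma : 'S_N) (-1) ^+ sigma * \prod_i C (sigma i) (f i)
    = \det (\matrix_(i, j) C j (f i)).
  rewrite /determinant; apply: eq_bigr => sigma _; congr (_ * _).
  by apply: eq_bigr => i _; rewrite mxE.
have [/injectiveP/leq_card|/injectivePn[i [j ij fij]]] := boolP (injectiveb f).
  by rewrite !card_ord leqNgt mN.
rewrite (determinant_alternate ij) ?scale0r // => k.
by rewrite !mxE fij.
Qed.

(** Reduction modulo [mu] expresses all powers of [b] through the first [(size mu).-1], the degree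
    of [mu], which is less than [N]. *)
Lemma capelli_eval_minimal_poly (A : falgType K) (b : A) (x : nat -> A)
    (mu : {poly K}) :
    mu != 0 -> horner_alg b mu = 0 -> (size mu <= N)%N ->
  capelli_eval b x = 0.
Proof.
move=> mu0 mub muN; have mu_gt0 : (0 < size mu)%N by rewrite lt0n size_poly_eq0.
apply: (@capelli_eval_dependent A b x (size mu).-1 (fun k => b ^+ k)
  (fun i k => ('X^i %% mu)`_k)); first by rewrite prednK.
move=> i; have {1}-> : b ^+ i = horner_alg b ('X^i %% mu).
  have -> : b ^+ i = horner_alg b 'X^i by rewrite rmorphXn /= horner_algX.
  by rewrite {1}(divp_eq 'X^i mu) rmorphD rmorphM /= mub mulr0 add0r.
have sz : (size ('X^i %% mu)%R <= (size mu).-1)%N.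
  by rewrite -ltnS prednK // ltn_modp.
rewrite horner_algE (big_ord_widen _ (fun k => ('X^i %% mu)`_k *: b ^+ k) sz).
rewrite big_mkcond; apply: eq_bigr => k _.
by case: ltnP => // h; rewrite nth_default // scale0r.
Qed.

Lemma capelli_eval_morph (A A' : algType K) (phi : {linear A -> A'}) b x :
    (forall a c, phi (a * c) = phi a * phi c) -> phi 1 = 1 ->
  phi (capelli_eval b x) = capelli_eval (phi b) (phi \o x).
Proof.
move=> phiM phi1; rewrite linear_sum; apply: eq_bigr => sigma _.
rewrite linearZ /= (big_morph phi phiM phi1); congr (_ *: _).
apply: eq_bigr => i _; rewrite phiM; congr (_ * _).
by elim: (nat_of_ord _) => [|k IH]; rewrite ?expr0 // !exprS phiM IH.
Qed.

End Capelli.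

Lemma exists_uniq_seq (K : closedFieldType) n :
  exists2 r : seq K, uniq r & size r = n.
Proof.
elim: n => [|n [r ur rn]]; first by exists [::].
have [|z] := @exists_nonroot K (\prod_(y <- r) ('X - y%:P)).
  by rewrite monic_neq0 // monic_prod_XsubC.
rewrite -/(root _ z) root_prod_XsubC => zr.
by exists (z :: r); rewrite /= ?zr ?ur ?rn.
Qed.

(** In row 0 each product follows the single path 0, 1, ..., n, collecting the powers of the
    diagonal entries. The alternating sum of the corner entries is a Vandermonde determinant with
    distinct nodes. *)
Lemma capelli_matrix_neq0 (K : closedFieldType) n :
  exists b (x : nat -> 'M[K]_n.+1),
    [/\ b^T = b, forall i, (x i)^T = x i & capelli_eval n.+1 b x != 0].
Proof.
have [r ur rn] := exists_uniq_seq K n.+1.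
pose d : 'rV[K]_n.+1 := \row_i r`_i.
pose e (i : nat) : 'rV[K]_n.+1 := delta_mx 0 (inord i).
(* The path has only [n] edges, so the last of the [n.+1] factors is the identity. *)
pose x i : 'M[K]_n.+1 := if (i < n)%N then
  delta_mx (inord i) (inord i.+1) + delta_mx (inord i.+1) (inord i) else 1.
exists (diag_mx d), x; split; first exact: tr_diag_mx.
  move=> i; rewrite /x; case: ifP => _; last exact: trmx1.
  by rewrite linearD /= !trmx_delta addrC.
have ed i k : e i *m diag_mx d ^+ k = r`_(inord i : 'I_n.+1) ^+ k *: e i.
  elim: k => [|k IH]; first by rewrite expr0 mulmx1 scale1r.
  rewrite exprSr mulmxA IH -scalemxAl exprSr -scalerA; congr (_ *: _).
  rewrite mul_mx_diag; apply/rowP => j; rewrite !mxE eqxx /=.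
  by case: eqP => [->|_]; rewrite ?mul0r ?mulr0 // mul1r mulr1.
have ex i : (i < n)%N -> e i *m x i = e i.+1.
  move=> ni; rewrite /x ni mulmxDr !mul_delta_mx_cond eqxx mulr1n.
  have -> : (inord i == inord i.+1 :> 'I_n.+1) = false.
    by rewrite -val_eqE /= !inordK ?ltn_eqF // ?ltnS ltnW.
  by rewrite mulr0n addr0.
have path (sigma : 'S_n.+1) k : (k <= n)%N ->
    e 0 *m \prod_(0 <= i < k) (diag_mx d ^+ sigma (inord i) * x i) =
    (\prod_(0 <= i < k) r`_(inord i : 'I_n.+1) ^+ sigma (inord i)) *: e k.
  elim: k => [|k IH] kn; first by rewrite !big_nil mulmx1 scale1r.
  rewrite !big_nat_recr //= mulmxA IH ?(ltnW kn) // -scalemxAl mulmxA ed.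
  by rewrite -scalemxAl ex // scalerA.
have entry (sigma : 'S_n.+1) :
    (\prod_(i < n.+1) (diag_mx d ^+ sigma i * x i)) 0 ord_max =
    \prod_(i < n.+1) r`_i ^+ sigma i.
  have -> : \prod_(i < n.+1) (diag_mx d ^+ sigma i * x i) =
      \prod_(0 <= i < n.+1) (diag_mx d ^+ sigma (inord i) * x i).
    by rewrite big_mkord; apply: eq_bigr => i _; rewrite inord_val.
  have -> : \prod_(i < n.+1) r`_i ^+ sigma i =
      \prod_(0 <= i < n.+1) r`_(inord i : 'I_n.+1) ^+ sigma (inord i).
    by rewrite big_mkord; apply: eq_bigr => i _; rewrite inord_val.
  set M := \prod_(0 <= i < n.+1) (_ * _).
  have -> : M 0 ord_max = (e 0 *m M) 0 ord_max.
    by rewrite -rowE mxE; congr (M _ _); apply: val_inj; rewrite /= inordK.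
  rewrite /M !big_nat_recr //= mulmxA path // -scalemxAl mulmxA ed.
  rewrite {1}/x ltnn mulmx1 scalerA mxE /e mxE eqxx /=.
  rewrite (_ : inord n = ord_max) ?eqxx ?mulr1 //.
  by apply: val_inj; rewrite /= inordK.
apply/eqP => /matrixP/(_ 0 ord_max); rewrite /capelli_eval summxE [RHS]mxE.
have -> : \sum_sigma ((-1) ^+ (sigma : 'S_n.+1) *:
      \prod_(i < n.+1) (diag_mx d ^+ sigma i * x i)) 0 ord_max
    = \det (Vandermonde n.+1 d)^T.
  rewrite /determinant; apply: eq_bigr => sigma _; rewrite mxE entry.
  by congr (_ * _); apply: eq_bigr => i _; rewrite !mxE.
rewrite det_tr det_Vandermonde => /eqP; apply/negP.
apply/prodf_neq0 => i _; apply/prodf_neq0 => j ij.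
by rewrite !mxE subr_eq0 nth_uniq ?rn // gtn_eqF.
Qed.

(** * From the inclusion of identities to the embedding *)

Theorem theorem6 (K : closedFieldType) (char_neq2 : 2%N \notin [pchar K])
    (A B : falgType K) (sA : involution A) (sB : involution B)
    (csaA : central_simple A) (csaB : central_simple B)
    (orthA : orthogonal_type sA)
    (IdBA : forall f : free_alg K, star_identity sB f -> star_identity sA f) :
  exists phi : {linear A -> B}, star_embedding sA sB phi.
Proof.
have [_ simpleB] := csaB.
have [n [psi [[psi_inj psiM psi_star] [psi' psiK psi'K]]]] := orthA.
(* The size bound says that [b] has degree at least [n.+1], the matrix size of [A]. Without such a
   [b], the Capelli-type polynomial would be an identity of [B], hence of [A]. *)
have [b [mu [sb mu0 muP mu_n]]] : exists b (mu : {poly K}),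
    [/\ sB b = b, mu != 0, forall p, horner_alg b p = 0 <-> mu %| p
       & (n.+1 < size mu)%N].
  apply: NNPP => nob.
  have /IdBA idA : star_identity sB (capelli K n.+1).
    move=> u v su _; rewrite free_eval_capelli.
    have [mu mu0 muP] := minimal_poly (u 0%N).
    apply: (capelli_eval_minimal_poly _ mu0); first exact/muP.
    rewrite leqNgt; apply/negP => h; apply: nob.
    by exists (u 0%N), mu; split=> //; apply: su.
  have [b [x [sb sx /eqP bx]]] := capelli_matrix_neq0 K n; apply: bx.
  have psi'_sym a : a^T = a -> symmetric_elt sA (psi' a).
    by move=> sa; apply: psi_inj; rewrite psi_star psi'K.
  (* Embeddings need not be unital, but surjectivity of [psi] makes [psi 1] a unit element. *)
  have psi1 : psi 1 = 1.
    by rewrite -[LHS]mulr1 -[X in _ * X](psi'K 1) -psiM mul1r psi'K.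
  pose u i := if i is j.+1 then psi' (x j) else psi' b.
  have := idA u (fun=> 0) _ _; rewrite free_eval_capelli.
  move=> /(_ _ _)/(congr1 psi).
  rewrite capelli_eval_morph // linear0 /= psi'K => <-.
  - apply: eq_bigr => sigma _; congr (_ *: _); apply: eq_bigr => i _.
    by rewrite /= psi'K.
  - by case=> [|i]; apply: psi'_sym.
  - by move=> _; rewrite /skew_elt linear0 oppr0.
have [u [u0 su umin]] := minimal_symmetric sB.
have [x xP] := orthonormal_family char_neq2 simpleB u0 su umin sb mu0 muP mu_n.
have [phi [phi_inj phiM phi_star]] := matrix_embedding u0 su xP.
exists (phi \o psi); split=> [|a c|a] /=.
- exact: inj_comp.
- by rewrite psiM phiM.
- by rewrite psi_star phi_star.
Qed.
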